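(* Let $A:\mathcal{H}_1\to\mathcal{H}_2$ be a nonzero bounded linear operator between real Hilbert spaces, let $T:\mathcal{H}_2\to\mathcal{H}_2$ be $\rho$-SQNE, where $\rho\ge 0$, and let $S\subseteq\mathcal{H}_2$ be nonempty. Assume that $\operatorname{im}A\cap\operatorname{Fix}T\neq\emptyset$. Let $\mathcal{L}_\sigma\{T\}:\mathcal{H}_1\to\mathcal{H}_1$ be the extrapolated Landweber operator with $\sigma=\tau$, where $$\tau(x):=\begin{cases}\left(\dfrac{\|A\|\cdot\|T(Ax)-Ax\|}{\|A^*(T(Ax)-Ax)\|}\right)^2, & \text{if }Ax\notin\operatorname{Fix}T,\\ 1,&\text{if }Ax\in\operatorname{Fix}T.\end{cases}$$ Then the following statements hold. (i) If $T$ is weakly regular over $S$, then $\mathcal{L}_\sigma\{T\}$ is weakly regular over $A^{-1}(S)$. (ii) If $\operatorname{im}A$ is closed, $T$ is regular over $S$, $S$ is bounded and $\{\operatorname{im}A,\operatorname{Fix}T\}$ is regular over $S$, then $\mathcal{L}_\sigma\{T\}$ is regular over $A^{-1}(S)$. (iii) If $\operatorname{im}A$ is closed, $T$ is linearly regular with modulus $\delta>0$ over $S$ and the family $\{\operatorname{im}A,\operatorname{Fix}T\}$ is linearly regular with modulus $\kappa>0$ over $S$, then $\mathcal{L}_\sigma\{T\}$ is linearly regular over $A^{-1}(S)$ with modulus $$\Delta:=\frac{\rho+1}{2}\left(\frac{\delta|A|}{\kappa\|A\|}\right)^2.$$ Moreover, for any $x\in A^{-1}(S)$, we have $$\|\mathcal{L}_\sigma\{T\}x-x\|\ge\sigma(x)\,\frac{\rho+1}{2}\left(\frac{\delta|A|}{\kappa\|A\|}\right)^2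 d\big(x,\operatorname{Fix}\mathcal{L}_\sigma\{T\}\big).$$
   Context: $\mathcal{H}_1,\mathcal{H}_2$ are real Hilbert spaces; $A^*$ is the adjoint of $A$, $\operatorname{im}A$ its image, $\|A\|$ its operator norm, and $|A|:=\inf\{\|Ax\| : x\in(\ker A)^\perp,\ \|x\|=1\}$. $\operatorname{Fix}T$ is the fixed point set of $T$, $d(x,C)=\inf_{c\in C}\|x-c\|$, and $\rightharpoonup$ denotes weak convergence. Landweber operator: $\mathcal{L}\{T\}x:=x+\frac{1}{\|A\|^2}A^*(T(Ax)-Ax)$ for $x\in\mathcal{H}_1$. For a function $\sigma:\mathcal{H}_1\to[1,\infty)$ the extrapolated Landweber operator is $\mathcal{L}_\sigma\{T\}x:=x+\sigma(x)(\mathcal{L}\{T\}x-x)$. (Under the hypotheses, $A^*(T(Ax)-Ax)=0$ if and only if $Ax\in\operatorname{Fix}T$, and $\tau\ge1$, so $\tau$ is well defined as such a function.) $\rho$-SQNE ($\rho$-strongly quasi-nonexpansive, $\rho\ge 0$): $T$ (not necessarily linear) has $\operatorname{Fix}T\ne\emptyset$ and $\|Tx-z\|^2\le\|x-z\|^2-\rho\|Tx-x\|^2$ for all $x$ and all $z\in\operatorname{Fix}T$. Regular operators. An operator $U$ on a Hilbert space $\mathcal{H}$ with $\operatorname{Fix}U\neq\emptyset$ is, over a set $S\subseteq\mathcal{H}$: - weakly regular if for any sequence $\{x_k\}\subseteq S$ and any $x_\infty\in\mathcal{H}$, whenever a subsequence $x_{n_k}\rightharpoonup x_\infty$ and $Ux_k-x_k\to0$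 then $x_\infty\in\operatorname{Fix}U$; - regular if for any sequence $\{x_k\}\subseteq S$, $\|Ux_k-x_k\|\to0$ implies $d(x_k,\operatorname{Fix}U)\to0$; - linearly regular with modulus $\delta>0$ if $\|Ux-x\|\ge\delta\, d(x,\operatorname{Fix}U)$ for every $x\in S$. Regular families of sets. A family $\{C_1,\dots,C_m\}$ of closed convex sets with $C:=\bigcap_iC_i\neq\emptyset$ is, over a set $S$: - regular if for any sequence $\{x_k\}\subseteq S$, $\max_i d(x_k,C_i)\to0$ implies $d(x_k,C)\to0$; - linearly regular with modulus $\kappa>0$ if $d(x,C)\le\kappa\max_i d(x,C_i)$ for every $x\in S$. *)

(* Defs.v *)
From HB Require Import structures.
From mathcomp Require Import all_boot all_order all_algebra.
From mathcomp Require Import all_classical all_reals all_analysis.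

Set Implicit Arguments.
Unset Strict Implicit.
Unset Printing Implicit Defensive.

Import Order.TTheory GRing.Theory Num.Theory.
Import numFieldNormedType.Exports.

Local Open Scope classical_set_scope.
Local Open Scope ring_scope.

(* Real Hilbert spaces: complete normed spaces over the reals whose norm comes
   from a (symmetric, bilinear, positive definite) inner product. *)
HB.mixin Record CompleteNormedModule_isHilbert (R : realType) H
    of CompleteNormedModule R H := {
  inner : {dot H for (@idfun R)} ;
  innerxx : forall x : H, inner x x = `|x| ^+ 2
}.

#[short(type="hilbertType")]
HB.structure Definition Hilbert (R : realType) :=
  {H of CompleteNormedModule_isHilbert R H & CompleteNormedModule R H}.

Section Operators.
Context {R : realType}.

Definition weak_cvg (H : hilbertType R) (x : nat -> H) (l : H) :=
  forall y : H, (inner (x k) y) @[k --> \oo] --> (inner l y : R).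

Definition ortho_compl (H : hilbertType R) (M : set H) : set H :=
  [set x | forall y, M y -> inner x y = 0 :> R].

(* Meaningful for C nonempty: the real-valued inf of set0 is 0. *)
Definition dist (H : hilbertType R) (x : H) (C : set H) : R :=
  inf [set `|x - c| | c in C].

Definition opnorm (H1 H2 : hilbertType R) (A : H1 -> H2) : R :=
  sup [set `|A x| | x in [set x | `|x| <= 1]].

(* The number |A| attached to an operator, not to be confused with its norm. *)
Definition min_modulus (H1 H2 : hilbertType R) (A : H1 -> H2) : R :=
  inf [set `|A x| | x in [set x | ortho_compl [set z | A z = 0] x
                                  /\ `|x| = 1]].

(* For A linear and bounded, the Riesz representation theorem gives a unique z
   satisfying the defining condition; the default 0 is then never used. *)
Definition adjoint (H1 H2 : hilbertType R) (A : H1 -> H2) (y : H2) : H1 :=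
  xget 0 [set z : H1 | forall x : H1, inner (A x) y = inner x z :> R].

Definition Fix (H : hilbertType R) (T : H -> H) : set H := [set x | T x = x].

Definition SQNE (H : hilbertType R) (rho : R) (T : H -> H) :=
  Fix T !=set0 /\
  forall x z, Fix T z ->
    `|T x - z| ^+ 2 <= `|x - z| ^+ 2 - rho * `|T x - x| ^+ 2.

Definition landweber (H1 H2 : hilbertType R) (A : H1 -> H2) (T : H2 -> H2)
    (x : H1) : H1 :=
  x + (opnorm A ^+ 2)^-1 *: adjoint A (T (A x) - A x).

Definition extrapolated_landweber (H1 H2 : hilbertType R) (A : H1 -> H2)
    (sigma : H1 -> R) (T : H2 -> H2) (x : H1) : H1 :=
  x + sigma x *: (landweber A T x - x).

Definition tau (H1 H2 : hilbertType R) (A : H1 -> H2) (T : H2 -> H2)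
    (x : H1) : R :=
  if A x \in Fix T then 1
  else (opnorm A * `|T (A x) - A x| / `|adjoint A (T (A x) - A x)|) ^+ 2.

Definition weakly_regular (H : hilbertType R) (U : H -> H) (S : set H) :=
  Fix U !=set0 /\
  forall (x : nat -> H) (l : H) (n : nat -> nat),
    (forall k, S (x k)) ->
    increasing_seq n -> weak_cvg (x \o n) l ->
    (U (x k) - x k) @[k --> \oo] --> (0 : H) ->
    Fix U l.

Definition regular (H : hilbertType R) (U : H -> H) (S : set H) :=
  Fix U !=set0 /\
  forall x : nat -> H, (forall k, S (x k)) ->
    `|U (x k) - x k| @[k --> \oo] --> (0 : R) ->
    dist (x k) (Fix U) @[k --> \oo] --> (0 : R).

Definition linearly_regular (H : hilbertType R) (U : H -> H) (S : set H)
    (delta : R) :=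
  [/\ Fix U !=set0, 0 < delta &
      forall x, S x -> delta * dist x (Fix U) <= `|U x - x|].

(* Finite families of sets are given as sequences. The notions below are meant
   for families of closed convex sets; closedness and convexity do not enter
   the conditions. *)
Definition family_meet (H : hilbertType R) (Cs : seq (set H)) : set H :=
  \big[setI/setT]_(C <- Cs) C.

Definition max_dist (H : hilbertType R) (x : H) (Cs : seq (set H)) : R :=
  \big[Order.max/0]_(C <- Cs) dist x C.

Definition regular_family (H : hilbertType R) (Cs : seq (set H))
    (S : set H) :=
  family_meet Cs !=set0 /\
  forall x : nat -> H, (forall k, S (x k)) ->
    max_dist (x k) Cs @[k --> \oo] --> (0 : R) ->
    dist (x k) (family_meet Cs) @[k --> \oo] --> (0 : R).

Definition linearly_regular_family (H : hilbertType R) (Cs : seq (set H))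
    (S : set H) (kappa : R) :=
  [/\ family_meet Cs !=set0, 0 < kappa &
      forall x, S x -> dist x (family_meet Cs) <= kappa * max_dist x Cs].

End Operators.

(* Main.v *)
Require Import Defs.
From HB Require Import structures.
From mathcomp Require Import all_boot all_order all_algebra.
From mathcomp Require Import all_classical all_reals all_analysis.
From mathcomp Require Import ring lra.
Import Order.TTheory GRing.Theory Num.Theory.
Import numFieldNormedType.Exports.
Local Open Scope classical_set_scope.
Local Open Scope ring_scope.

(** Put [u = T (A x) - A x] and [g = adjoint A u].  The choice of [tau] makes the
step [L x - x] equal to [(`|u| ^+ 2 / `|g| ^+ 2) *: g], so that
[`|L x - x| = `|u| ^+ 2 / `|g|] ([norm_extrapolated_landweber_subr]), where division
by [0] gives [0].  Since [T] is strongly quasi-nonexpansive, every [c] with [A c]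
in [Fix T] satisfies
[(rho + 1) / 2 * `|u| ^+ 2 <= inner (c - x) g] ([residual_inner_ge]).  As such a [c]
exists, [g = 0] forces [u = 0], and therefore [Fix L = A @^-1` Fix T].

Two estimates then carry the theorem.  First, [`|g| <= opnorm A * `|u|] gives
[`|u| <= opnorm A * `|L x - x|] ([residual_le]): if the steps of [L] tend to [0],
so do the residuals of [T] at the points [A x].  With the weak continuity of [A]
this is the statement on weak regularity.  Secondly, moving inside the orthogonal
complement of the kernel of [A] gives
[min_modulus A * dist x (Fix L) <= dist (A x) (range A `&` Fix T)]
([dist_preimage_le]).  When the range of [A] is closed, [min_modulus A] is positive
([min_modulus_gt0]), so distances to [range A `&` Fix T] control distances to
[Fix L], which is the statement on regularity.

For linear regularity, the hypotheses and the second estimate give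
[delta * min_modulus A / kappa * dist x (Fix L) <= `|u|]
([dist_Fix_le_residual]), while Cauchy-Schwarz in [residual_inner_ge] gives
[(rho + 1) / 2 * `|u| ^+ 2 <= `|g| * dist x (Fix L)] ([residual_dist_le]).  Combining
them and dividing by [dist x (Fix L)] bounds [`|g|] from below, and the step has
norm [tau A T x / opnorm A ^+ 2 * `|g|].

The functional analysis behind this is the projection on a closed subspace, the
Riesz representation theorem (hence the existence of the adjoint), and the
positivity of [min_modulus A], which is derived from the uniform boundedness
principle applied to the adjoint. *)

Set Implicit Arguments.
Unset Strict Implicit.
Unset Printing Implicit Defensive.

(** * Real inner products *)

Section InnerProduct.
Context {R : realType} {H : hilbertType R}.
Implicit Types (x y z : H) (a : R).

Lemma innerC x y : inner x y = inner y x :> R.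
Proof. by rewrite (hermC inner) expr0 mul1r. Qed.

Lemma innerDl x y z : inner (x + y) z = inner x z + inner y z :> R.
Proof. by rewrite linearDl. Qed.

Lemma innerDr x y z : inner z (x + y) = inner z x + inner z y :> R.
Proof. by rewrite linearDr. Qed.

Lemma innerBl x y z : inner (x - y) z = inner x z - inner y z :> R.
Proof. by rewrite linearBl. Qed.

Lemma innerBr x y z : inner z (x - y) = inner z x - inner z y :> R.
Proof. by rewrite linearBr. Qed.

Lemma innerZl a x z : inner (a *: x) z = a * inner x z :> R.
Proof. by rewrite linearZl_LR. Qed.

Lemma innerZr a x z : inner z (a *: x) = a * inner z x :> R.
Proof. by rewrite linearZr_LR. Qed.

Lemma inner0r z : inner z 0 = 0 :> R.
Proof. by rewrite linear0r. Qed.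

Lemma sqr_normD x y : `|x + y| ^+ 2 = `|x| ^+ 2 + 2 * inner x y + `|y| ^+ 2 :> R.
Proof. by rewrite -!innerxx !innerDl !innerDr (innerC y x); ring. Qed.

Lemma sqr_normB x y : `|x - y| ^+ 2 = `|x| ^+ 2 - 2 * inner x y + `|y| ^+ 2 :> R.
Proof. by rewrite -!innerxx !innerBl !innerBr (innerC y x); ring. Qed.

Lemma inner_inj y z : (forall x, inner x y = inner x z :> R) -> y = z.
Proof.
move=> yz; apply/eqP; rewrite -subr_eq0 -normr_eq0 -sqrf_eq0 -innerxx.
by rewrite innerBr yz subrr.
Qed.

Lemma cauchy_schwarz x y : `|inner x y : R| <= `|x| * `|y|.
Proof.
have [->|y0] := eqVneq y 0; first by rewrite inner0r !normr0 mulr0.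
have y2_gt0 : 0 < `|y| ^+ 2 :> R by rewrite exprn_gt0// normr_gt0.
(* This vector is [`|y| ^+ 2] times the component of [x] orthogonal to [y]. *)
have := sqr_ge0 `| `|y| ^+ 2 *: x - (inner x y : R) *: y|.
rewrite sqr_normB innerZl innerZr !normrZ !exprMn !real_normK ?num_real//.
have -> : (`|y| ^+ 2) ^+ 2 * `|x| ^+ 2
   - 2 * (`|y| ^+ 2 * ((inner x y : R) * inner x y))
   + (inner x y : R) ^+ 2 * `|y| ^+ 2
  = `|y| ^+ 2 * ((`|x| * `|y|) ^+ 2 - (inner x y : R) ^+ 2) by ring.
rewrite pmulr_rge0// subr_ge0 -[(inner x y : R) ^+ 2]real_normK ?num_real//.
by rewrite ler_pXn2r// nnegrE// mulr_ge0.
Qed.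

Lemma inner_continuous y : continuous (fun x => inner x y : R).
Proof.
apply: (@bounded_linear_continuous R H R^o (applyr inner y)).
apply/linear_boundedP; exists `|y|; split=> [|r yr x]; first exact: num_real.
by apply: le_trans (cauchy_schwarz x y) _; rewrite mulrC ler_wpM2r// ltW.
Qed.
End InnerProduct.

(** * Distance to a set *)

Lemma inf_ge0 {R : realType} (E : set R) :
  (forall r, E r -> 0 <= r) -> 0 <= inf E.
Proof.
move=> E0; have [->|/set0P Ene] := eqVneq E set0; first by rewrite inf0.
exact: lb_le_inf.
Qed.

Section Distance.
Context {R : realType} {H : hilbertType R}.
Implicit Types (x c : H) (C : set H).

Lemma dist_le x C c : C c -> dist x C <= `|x - c|.
Proof.
move=> Cc; apply: ge_inf; last by exists c.
by exists 0 => _ [z _ <-].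
Qed.

(** For empty [C] the infimum is [0], which need not be at least [b]. *)
Lemma dist_ge x C (b : R) : C !=set0 ->
  (forall c, C c -> b <= `|x - c|) -> b <= dist x C.
Proof.
move=> [c Cc] bC; apply: lb_le_inf; first by exists `|x - c|, c.
by move=> _ [z Cz <-]; exact: bC.
Qed.

Lemma dist_ge0 x C : 0 <= dist x C.
Proof.
by apply: inf_ge0 => _ [z _ <-].
Qed.

Lemma dist_mem x C : C x -> dist x C = 0.
Proof.
move=> Cx; apply/eqP; rewrite eq_le dist_ge0 andbT.
by have := dist_le x Cx; rewrite subrr normr0.
Qed.
End Distance.

(** * Orthogonal projection and Riesz representation *)

(** Packages the Cauchy criterion for the two completeness arguments below,
where the distance of two terms is controlled by the error of each. *)
Lemma cvg_of_dist_le (R : realType) (V : completeNormedModType R)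
    (u : nat -> V) (e : nat -> R) :
  e @ \oo --> (0 : R) -> (forall n k, `|u n - u k| <= e n + e k) ->
  cvgn u.
Proof.
move=> e0 ue; apply/cauchy_cvgP/cauchy_ballP => d d0.
rewrite !near_simpl -ball_normE /=; near=> n k => /=.
rewrite (le_lt_trans (ue n k))// [ltRHS]splitr ltrD//.
- rewrite (le_lt_trans (ler_norm _))//; near: n.
  by apply: cvgr0_norm_lt => //; rewrite divr_gt0.
- rewrite (le_lt_trans (ler_norm _))//; near: k.
  by apply: cvgr0_norm_lt => //; rewrite divr_gt0.
Unshelve. all: by end_near. Qed.

Lemma closed_of_cvg (R : realType) (V : normedModType R) (M : set V) :
  (forall (u : nat -> V) x, (forall n, M (u n)) -> u @ \oo --> x -> M x) ->
  closed M.
Proof.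
move=> Mcvg x clx.
have near_x (n : nat) : exists y, M y /\ `|x - y| < harmonic n :> R.
  have [|y [My xy]] := clx (ball x (harmonic n)).
    by apply: nbhsx_ballx; rewrite invr_gt0.
  by exists y; split => //; rewrite -ball_normE in xy.
have [u uM] := choice near_x.
apply: (Mcvg u) => [n|]; first by have [] := uM n.
apply/cvgrPdist_lt => e e0; near=> n.
have [_ /lt_trans] := uM n; apply; rewrite (le_lt_trans (ler_norm _))//.
by near: n; apply: cvgr0_norm_lt => //; exact: cvg_harmonic.
Unshelve. all: by end_near. Qed.

Definition linear_subspace (R : realType) (V : lmodType R) (M : set V) :=
  M 0 /\ forall (a : R) x y, M x -> M y -> M (a *: x + y).

Section Projection.
Context {R : realType} {H : hilbertType R}.
Implicit Types (x y m : H) (M : set H).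

(** First-order optimality: moving [m] by a small multiple of [y] cannot
decrease the distance to [x], so the derivative in the direction [y]
vanishes. *)
Lemma ortho_compl_of_nearest M x m : linear_subspace M -> M m ->
  (forall y, M y -> `|x - m| ^+ 2 <= `|x - y| ^+ 2) -> ortho_compl M (x - m).
Proof.
move=> [_ MD] Mm nearest y My; set b : R := inner (x - m) y.
set q : R := `|y| ^+ 2; have q0 : 0 <= q by exact: sqr_ge0.
have q1 : 1 + q != 0 by rewrite gt_eqF// ltr_wpDr.
(* The best step is [b / q]; [1 + q] also covers the case [y = 0]. *)
have := nearest _ (MD (b / (1 + q)) _ _ My Mm).
rewrite opprD addrCA addrC [leRHS]sqr_normB innerZr normrZ exprMn.
rewrite real_normK ?num_real// -/b -/q => le0.
have : b ^+ 2 * (2 + q) <= 0.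
  have -> : b ^+ 2 * (2 + q)
      = (1 + q) ^+ 2 * (2 * (b / (1 + q) * b) - (b / (1 + q)) ^+ 2 * q).
    by field.
  by rewrite mulr_ge0_le0 ?sqr_ge0//; lra.
rewrite pmulr_lle0 ?ltr_wpDr// => b0.
by apply/eqP; rewrite -sqrf_eq0 eq_le b0 sqr_ge0.
Qed.

(** By the parallelogram law a sequence in [M] whose distances to [x] tend to
the infimum is Cauchy; its limit is the nearest point of [M] to [x], and the
difference is orthogonal to [M] by [ortho_compl_of_nearest]. *)
Lemma orthogonal_decomposition M x : closed M -> linear_subspace M ->
  exists2 m, M m & ortho_compl M (x - m).
Proof.
move=> Mcl linM; have [M0 MD] := linM.
pose E := [set `|x - m| ^+ 2 | m in M] : set R.
have Elb : has_lbound E by exists 0 => _ [m _ <-]; exact: sqr_ge0.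
have infE m : M m -> inf E <= `|x - m| ^+ 2 by move=> Mm; apply: ge_inf => //; exists m.
have minimizing (n : nat) :
    exists m, M m /\ `|x - m| ^+ 2 < inf E + (harmonic n : R) ^+ 2.
  have [||_ [m Mm <-] mlt] := @inf_adherent R E ((harmonic n) ^+ 2).
  - by rewrite exprn_gt0// invr_gt0.
  - by split => //; exists (`|x - 0| ^+ 2), 0.
  - by exists m.
have [u uM] := choice minimizing.
(* The parallelogram law bounds the square of the left-hand side by
   [2 * (harmonic n ^+ 2 + harmonic k ^+ 2)]. *)
have u_cauchy n k : `|u n - u k| <= 2 * harmonic n + 2 * harmonic k :> R.
  have [Mn ltn] := uM n; have [Mk ltk] := uM k.
  have Mmid : M (2^-1 *: (u n + u k)).
    rewrite -[_ *: _]addr0; apply: (MD) => //.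
    by rewrite -[u n]scale1r; exact: MD.
  have hn : 0 <= harmonic n :> R by rewrite invr_ge0.
  have hk : 0 <= harmonic k :> R by rewrite invr_ge0.
  rewrite -(@ler_pXn2r _ 2) ?nnegrE ?addr_ge0 ?mulr_ge0//.
  have := infE _ Mmid.
  (* The parallelogram law, applied to [x - u n] and [x - u k]. *)
  have -> : `|x - 2^-1 *: (u n + u k)| ^+ 2
     = (`|x - u n| ^+ 2 + `|x - u k| ^+ 2) / 2 - `|u n - u k| ^+ 2 / 4 :> R.
    rewrite !sqr_normB normrZ exprMn sqr_normD innerZr innerDr.
    by rewrite ger0_norm ?invr_ge0//; field.
  nra.
have e0 : (fun n => 2 * harmonic n) @ \oo --> (0 : R).
  by rewrite -[0](mulr0 2); apply: cvgMr; exact: cvg_harmonic.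
have /cvg_ex[m um] := cvg_of_dist_le e0 u_cauchy.
have Mm : M m by apply: (closed_cvg M Mcl _ m um); apply: nearW => n; case: (uM n).
exists m => //; apply: ortho_compl_of_nearest => // y My.
apply: le_trans (infE _ My).
have lhs : `|x - u n| ^+ 2 @[n --> \oo] --> (`|x - m| ^+ 2 : R).
  by apply: cvgM; apply: cvg_norm; apply: cvgB => //; exact: cvg_cst.
have rhs : inf E + (harmonic n) ^+ 2 @[n --> \oo] --> (inf E + 0 ^+ 2 : R).
  by apply: cvgD; [exact: cvg_cst|apply: cvgM; exact: cvg_harmonic].
rewrite -[inf E]addr0 -[X in _ <= _ + X](expr0n _ 2).
by apply: (ler_cvg_to lhs rhs); apply: nearW => n; case: (uM n) => _ /ltW.
Qed.

(** Subtracting from a point outside the kernel of [f] its projection on the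
kernel gives a vector [w] orthogonal to the kernel.  Since
[y - (f y / f w) *: w] is in the kernel for every [y], a multiple of [w]
represents [f]. *)
Lemma riesz (f : {scalar H}) : continuous (f : H -> R) ->
  exists z, forall x, f x = inner x z :> R.
Proof.
move=> fc; pose K : set H := [set x | f x = 0].
have Kcl : closed K.
  apply: (@closed_comp _ _ (f : H -> R) [set 0]); last exact: closed_eq.
  by move=> x _; exact: fc.
have linK : linear_subspace K.
  split=> [|a x y]; rewrite /K/= ?linear0// linearP => -> ->.
  by rewrite mulr0 addr0.
have [f0|/existsNP[x fx]] := pselect (forall x, f x = 0).
  by exists 0 => x; rewrite f0 inner0r.
have [m Km wK] := orthogonal_decomposition x Kcl linK.
set w := x - m in wK.
have fw : f w != 0 by rewrite linearB/= Km subr0; exact/eqP.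
have w0 : w != 0 by apply: contra_neq fw => ->; rewrite linear0.
have nw : `|w| ^+ 2 != 0 :> R by rewrite expf_neq0// normr_eq0.
exists ((f w / `|w| ^+ 2) *: w) => y.
have : inner w (y - (f y / f w) *: w) = 0 :> R.
  by apply: wK; rewrite /K/= linearB linearZ_LR/= divfK// subrr.
rewrite innerBr innerZr innerxx => /eqP; rewrite subr_eq0 => /eqP wy.
by rewrite innerZr innerC wy; field; rewrite fw normr_eq0.
Qed.
End Projection.

(** * Bounded operators, their adjoint and their minimal modulus *)

Section BoundedOperator.
Context {R : realType} {H1 H2 : hilbertType R}.
Variable A : {linear H1 -> H2}.
Hypothesis A_bounded : bounded_near A (nbhs (0 : H1)).

Lemma opnorm_ub x : `|x| <= 1 -> `|A x| <= opnorm A.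
Proof using A_bounded.
move=> x1; apply: ub_le_sup; last by exists x.
have /linear_boundedP[M [_ AM]] := A_bounded.
exists (`|M| + 1) => _ [z /= z1 <-].
have M1 : M < `|M| + 1 by rewrite (le_lt_trans (ler_norm M))// ltrDl.
by apply: le_trans (AM _ M1 z) _; rewrite ler_piMr// addr_ge0.
Qed.

Lemma opnorm_ge0 : 0 <= opnorm A.
Proof using A_bounded.
by have := @opnorm_ub 0; rewrite linear0 !normr0; apply; exact: ler01.
Qed.

Lemma opnorm_ge x : `|A x| <= opnorm A * `|x|.
Proof using A_bounded.
have [->|x0] := eqVneq x 0; first by rewrite linear0 !normr0 mulr0.
have nx : 0 < `|x| by rewrite normr_gt0.
rewrite -ler_pdivrMr// mulrC -[X in X * _]gtr0_norm ?invr_gt0// -normrZ -linearZ.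
by apply: opnorm_ub; rewrite normrZ gtr0_norm ?invr_gt0// mulVf// normr_eq0.
Qed.

Lemma opnorm_gt0 : (exists x, A x <> 0) -> 0 < opnorm A.
Proof using A_bounded.
move=> [x Ax0]; rewrite ltNge; apply/negP => A0; apply: Ax0.
apply/eqP; rewrite -normr_eq0 eq_le normr_ge0 andbT.
by apply: le_trans (opnorm_ge x) _; rewrite mulr_le0_ge0.
Qed.

(** Riesz representation of [fun x => inner (A x) y] shows that the set in which
[adjoint] chooses is inhabited, so that its default value is never taken. *)
Lemma adjointP x y : inner (A x) y = inner x (adjoint A y) :> R.
Proof using A_bounded.
have [|z fz] := riesz (f := applyr inner y \o A).
  move=> x0; apply: continuous_comp; last exact: inner_continuous.
  exact: bounded_linear_continuous.
by rewrite /adjoint; case: xgetP => [_ _ ->//|/(_ z)/(_ fz)].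
Qed.

Lemma adjointB y z : adjoint A (y - z) = adjoint A y - adjoint A z.
Proof using A_bounded.
by apply: inner_inj => x; rewrite innerBr -!adjointP innerBr.
Qed.

Lemma adjoint0 : adjoint A 0 = 0.
Proof using A_bounded. by rewrite -[in LHS](subrr 0) adjointB subrr. Qed.

Lemma adjoint_linear : linear (adjoint A).
Proof using A_bounded.
move=> a y z; apply: inner_inj => x.
by rewrite innerDr innerZr -!adjointP innerDr innerZr.
Qed.

Lemma norm_adjoint_le y : `|adjoint A y| <= opnorm A * `|y|.
Proof using A_bounded.
have [->|g0] := eqVneq (adjoint A y) 0.
  by rewrite normr0 mulr_ge0// opnorm_ge0.
rewrite -(@ler_pM2l _ `|adjoint A y|) ?normr_gt0//.
rewrite -expr2 -innerxx -adjointP (le_trans (ler_norm _))//.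
rewrite (le_trans (cauchy_schwarz _ _))// mulrCA mulrA ler_wpM2r//.
exact: opnorm_ge.
Qed.

Lemma weak_cvg_linear (x : nat -> H1) l :
  weak_cvg x l -> weak_cvg (A \o x) (A l).
Proof using A_bounded.
move=> xl y; rewrite adjointP.
by under eq_fun do rewrite /= adjointP; exact: xl.
Qed.

Lemma closed_ker : closed [set x | A x = 0].
Proof using A_bounded.
apply: (@closed_comp _ _ A [set 0]); last first.
  exact/accessible_closed_set1/hausdorff_accessible/norm_hausdorff.
by move=> x _; exact: bounded_linear_continuous.
Qed.

Lemma linear_subspace_ker : linear_subspace [set x | A x = 0].
Proof.
split=> [|a x y /=]; first exact: linear0.
by rewrite linearP => -> ->; rewrite scaler0 addr0.
Qed.

Lemma linear_subspace_range : linear_subspace (range A).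
Proof.
split=> [|a _ _ [x _ <-] [y _ <-]]; first by exists 0; rewrite ?linear0.
by exists (a *: x + y); rewrite ?linearP.
Qed.

Lemma min_modulus_le x : ortho_compl [set z | A z = 0] x ->
  min_modulus A * `|x| <= `|A x|.
Proof.
move=> xK; have [->|x0] := eqVneq x 0; first by rewrite linear0 !normr0 mulr0.
have nx : 0 < `|x| by rewrite normr_gt0.
rewrite -ler_pdivlMr// mulrC -[X in X * _]gtr0_norm ?invr_gt0// -normrZ -linearZ.
apply: ge_inf; first by exists 0 => _ [z _ <-].
exists (`|x|^-1 *: x) => //=; split.
  by move=> y /= Ay; rewrite innerZl xK// mulr0.
by rewrite normrZ gtr0_norm ?invr_gt0// mulVf// normr_eq0.
Qed.

Lemma min_modulus_ge0 : 0 <= min_modulus A.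
Proof. by apply: inf_ge0 => _ [v _ <-]. Qed.

(** Uniform boundedness.  Let [y] range over the vectors of the image of [A]
with [`|adjoint A y| <= 1].  Since the image is closed, the part of any [w] in
it is some [A v], and then [inner w y = inner v (adjoint A y)] is at most
[`|v|] in absolute value: the functionals [inner _ y] are pointwise bounded,
hence the vectors [y] are bounded in norm. *)
Lemma adjoint_bounded_below : closed (range A) ->
  exists2 M : R, 0 < M &
    forall y, range A y -> `|y| <= M * `|adjoint A y|.
Proof using A_bounded.
move=> Acl.
pose B := [set y | range A y /\ `|adjoint A y| <= 1].
pose F : set (H2 -> R^o) := [set applyr inner y | y in B].
have F_lin f : F f -> bounded_fun_norm f /\ linear f.
  move=> [y _ <-]; split; last exact: linearP.
  move=> r; exists (r * `|y|) => x xr.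
  by apply: le_trans (cauchy_schwarz x y) _; rewrite ler_wpM2r.
have F_pw : pointwise_bounded F.
  move=> w; have [_ [v _ <-] wK] :=
    orthogonal_decomposition w Acl linear_subspace_range.
  exists `|v| => _ [y [Ry y1] <-] /=.
  have /eqP := wK _ Ry; rewrite innerBl subr_eq0 => /eqP wy.
  rewrite /applyr wy adjointP (le_trans (cauchy_schwarz _ _))//.
  by rewrite ler_piMr.
have [M FM] := Banach_Steinhauss F_lin F_pw 1.
have B_bounded y : B y -> `|y| <= `|M|.
  move=> By; have [->|y0] := eqVneq y 0; first by rewrite normr0.
  have ny : 0 < `|y| by rewrite normr_gt0.
  have := FM (applyr inner y) (ex_intro2 _ _ y By erefl) (`|y|^-1 *: y).
  rewrite normrZ gtr0_norm ?invr_gt0// mulVf ?gt_eqF// => /(_ (lexx _)).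
  rewrite /applyr innerZl innerxx expr2 mulKf ?gt_eqF// normr_id => yM.
  exact: le_trans yM (ler_norm M).
(* The normalisation below needs [adjoint A y] to be nonzero. *)
have adj_inj y : range A y -> adjoint A y = 0 -> y = 0.
  move=> [x _ <-] Ax; apply/eqP.
  by rewrite -normr_eq0 -sqrf_eq0 -innerxx adjointP Ax inner0r.
exists (`|M| + 1) => [|y Ry]; first by rewrite ltr_wpDl.
have [gy|gy] := eqVneq (adjoint A y) 0.
  by rewrite (adj_inj _ Ry gy) adjoint0 !normr0 mulr0.
have ng : 0 < `|adjoint A y| by rewrite normr_gt0.
rewrite -ler_pdivrMr// mulrC -[X in X * _]gtr0_norm ?invr_gt0// -normrZ.
apply: (@le_trans _ _ `|M|); last by rewrite lerDl.
apply: B_bounded; split.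
  have [R0 RD] := linear_subspace_range.
  by rewrite -[_ *: _]addr0; exact: RD.
rewrite -[_ *: y]addr0 adjoint_linear adjoint0 addr0 normrZ.
by rewrite gtr0_norm ?invr_gt0// mulVf// gt_eqF.
Qed.

(** The image under the adjoint of [range A] is closed, because the adjoint is
bounded below there.  The part of [x] orthogonal to that image lies in the
kernel of [A], to which [x] is orthogonal as well, so it is zero. *)
Lemma ortho_compl_ker_adjoint : closed (range A) ->
  forall x, ortho_compl [set z | A z = 0] x ->
  exists2 y, range A y & x = adjoint A y.
Proof using A_bounded.
move=> Acl x xK; have [M M0 AM] := adjoint_bounded_below Acl.
have [R0 RD] := linear_subspace_range.
pose N := [set adjoint A y | y in range A].
have linN : linear_subspace N.
  split=> [|a _ _ [y Ry <-] [z Rz <-]]; first by exists 0; rewrite ?adjoint0.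
  by exists (a *: y + z); [exact: RD|exact: adjoint_linear].
have Ncl : closed N.
  apply: closed_of_cvg => u l uN ul.
  have /choice[y yP] : forall n, exists y, range A y /\ adjoint A y = u n.
    by move=> n; have [y Ry yu] := uN n; exists y.
  have y_cauchy n k : `|y n - y k| <= M * `|u n - l| + M * `|u k - l|.
    have [[Rn un] [Rk uk]] := (yP n, yP k).
    have Rnk : range A (y n - y k) by rewrite addrC -scaleN1r; exact: RD.
    apply: le_trans (AM _ Rnk) _; rewrite -mulrDr ler_pM2l//.
    rewrite adjointB un uk (distrC (u k)).
    by apply: le_trans (ler_normD _ _); rewrite addrA subrK.
  have e0 : M * `|u n - l| @[n --> \oo] --> (0 : R).
    rewrite -(mulr0 M); apply: cvgMr; rewrite -(normr0 H1) -(subrr l).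
    by apply: cvg_norm; apply: cvgB => //; exact: cvg_cst.
  have /cvg_ex[z yz] := cvg_of_dist_le e0 y_cauchy.
  have Rz : range A z.
    by apply: (closed_cvg _ Acl _ z yz); apply: nearW => n; case: (yP n).
  exists z => //; apply: inner_inj => w; rewrite -adjointP.
  have wl : inner w (u n) @[n --> \oo] --> (inner w l : R).
    rewrite innerC; under eq_fun do rewrite innerC.
    exact: (cvg_comp _ _ ul (@inner_continuous _ _ w l)).
  have wz : inner w (u n) @[n --> \oo] --> (inner (A w) z : R).
    rewrite innerC.
    have -> : (fun n => inner w (u n) : R) = (fun n => inner (y n) (A w) : R).
      by apply/funext => n; have [_ <-] := yP n; rewrite -adjointP innerC.
    exact: (cvg_comp _ _ yz (@inner_continuous _ _ (A w) z)).
  exact: (cvg_unique _ wz wl).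
have [_ [y Ry <-] xN] := orthogonal_decomposition x Ncl linN.
have nAx : A (x - adjoint A y) = 0.
  apply/eqP; rewrite -normr_eq0 -sqrf_eq0 -innerxx adjointP xN//.
  by exists (A (x - adjoint A y)) => //; exists (x - adjoint A y).
exists y => //; apply/eqP; rewrite -subr_eq0 -normr_eq0 -sqrf_eq0 -innerxx.
by rewrite innerBl xK// sub0r innerC -adjointP nAx innerC inner0r oppr0.
Qed.

(** For a unit vector [x = adjoint A y] orthogonal to the kernel,
[1 = inner (A x) y <= `|A x| * `|y| <= `|A x| * M], where [M] is the constant of
[adjoint_bounded_below]. *)
Lemma min_modulus_gt0 : (exists x, A x <> 0) -> closed (range A) ->
  0 < min_modulus A.
Proof using A_bounded.
move=> [x0 Ax0] Acl; have [M M0 AM] := adjoint_bounded_below Acl.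
apply: (@lt_le_trans _ _ M^-1); first by rewrite invr_gt0.
apply: lb_le_inf.
  (* As [A] is nonzero, a unit vector orthogonal to its kernel exists;
     without one the infimum would be the default value [0]. *)
  have [m /= Km xm] := orthogonal_decomposition x0 closed_ker linear_subspace_ker.
  set w := x0 - m in xm.
  have w0 : w != 0.
    by apply/eqP => w0; apply: Ax0; rewrite -(subrK m x0) -/w w0 add0r.
  exists `|A (`|w|^-1 *: w)|, (`|w|^-1 *: w) => //=; split.
    by move=> y /= Ay; rewrite innerZl xm// mulr0.
  by rewrite normrZ gtr0_norm ?invr_gt0 ?normr_gt0// mulVf// normr_eq0.
move=> _ [x [xK x1] <-]; have [y Ry xy] := ortho_compl_ker_adjoint Acl xK.
rewrite -[M^-1]mul1r ler_pdivrMr//.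
have -> : 1 = inner (A x) y :> R by rewrite adjointP -xy innerxx x1 expr1n.
apply: le_trans (ler_norm _) _; apply: le_trans (cauchy_schwarz _ _) _.
by rewrite ler_wpM2l// (le_trans (AM _ Ry))// -xy x1 mulr1.
Qed.

(** To reach the preimage of [A z] from [x] it suffices to move along the part
of [z - x] orthogonal to the kernel, and on such vectors [A] expands the norm
by at least [min_modulus A]. *)
Lemma dist_preimage_le (C : set H2) x : range A `&` C !=set0 ->
  min_modulus A * dist x (A @^-1` C) <= dist (A x) (range A `&` C).
Proof using A_bounded.
move=> RC0; apply: dist_ge => // _ [[z _ <-] Cz].
have [m /= Km zm] :=
  orthogonal_decomposition (z - x) closed_ker linear_subspace_ker.
have Azm : A (z - x - m) = A z - A x by rewrite !linearB/= Km subr0.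
rewrite distrC -Azm; apply: le_trans (min_modulus_le zm).
apply: ler_wpM2l; first exact: min_modulus_ge0.
have -> : z - x - m = - (x - (z - m)) by rewrite opprB addrAC.
by rewrite normrN dist_le//= linearB/= Km subr0.
Qed.

End BoundedOperator.

(** * The extrapolated Landweber operator *)

Lemma family_meet2 (R : realType) (H : hilbertType R) (C D : set H) :
  family_meet [:: C; D] = C `&` D.
Proof. by rewrite /family_meet !big_cons big_nil setIT. Qed.

Lemma max_dist2_mem (R : realType) (H : hilbertType R) (C D : set H) y :
  C y -> max_dist y [:: C; D] = dist y D.
Proof.
move=> Cy; rewrite /max_dist !big_cons big_nil dist_mem//.
by rewrite (max_l (dist_ge0 _ _)) (max_r (dist_ge0 _ _)).
Qed.

(** Expanding [`|T y - z| ^+ 2 = `|(T y - y) - (z - y)| ^+ 2] turns the definition of a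
strongly quasi-nonexpansive operator into a separation of [y] from [Fix T]. *)
Lemma SQNE_inner_ge (R : realType) (H : hilbertType R) (rho : R)
    (T : H -> H) y z : SQNE rho T -> Fix T z ->
  (rho + 1) / 2 * `|T y - y| ^+ 2 <= inner (T y - y) (z - y).
Proof.
move=> [_ /(_ y z)] + Tz => /(_ Tz).
have -> : T y - z = (T y - y) - (z - y) by rewrite opprB addrA subrK.
rewrite sqr_normB (distrC y z); lra.
Qed.

Section ExtrapolatedLandweber.
Context {R : realType} {H1 H2 : hilbertType R}.
Variables (A : {linear H1 -> H2}) (T : H2 -> H2) (rho : R).
Hypothesis A_bounded : bounded_near A (nbhs (0 : H1)).
Hypothesis A_neq0 : exists x, A x <> 0.
Hypothesis rho_ge0 : 0 <= rho.
Hypothesis T_SQNE : SQNE rho T.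
Hypothesis AT_neq0 : range A `&` Fix T !=set0.

Let residual x := T (A x) - A x.
Let L := extrapolated_landweber A (tau A T) T.

(** The pullback of [SQNE_inner_ge] along [A]: the Landweber direction points
towards every [c] with [A c] in [Fix T]. *)
Lemma residual_inner_ge x c : Fix T (A c) ->
  (rho + 1) / 2 * `|residual x| ^+ 2
    <= inner (c - x) (adjoint A (residual x)).
Proof using A_bounded T_SQNE.
move=> Tc; rewrite -adjointP// innerC (linearB A).
exact: SQNE_inner_ge Tc.
Qed.

Lemma adjoint_residual_eq0 x :
  adjoint A (residual x) = 0 -> residual x = 0.
Proof using A_bounded rho_ge0 T_SQNE AT_neq0.
move=> g0; have [_ [[c _ <-] Tc]] := AT_neq0.
have := residual_inner_ge x Tc; rewrite g0 inner0r pmulr_rle0; last first.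
  by rewrite divr_gt0// ltr_wpDl.
move=> u0; apply/eqP; rewrite -normr_eq0 -sqrf_eq0 eq_le u0.
by rewrite sqr_ge0.
Qed.

Lemma extrapolated_landweber_subr x :
  L x - x = (tau A T x / opnorm A ^+ 2) *: adjoint A (residual x).
Proof.
by rewrite /L /extrapolated_landweber /landweber addrAC subrr add0r
  (addrAC x) subrr add0r scalerA.
Qed.

Lemma Fix_residual x : Fix T (A x) <-> residual x = 0.
Proof. by rewrite /Fix/residual/=; split=> [->|/subr0_eq//]; exact: subrr. Qed.

Lemma tau_nFix x : ~ Fix T (A x) ->
  tau A T x = (opnorm A * `|residual x| / `|adjoint A (residual x)|) ^+ 2.
Proof. by move=> nF; rewrite /tau ifF//; apply/negbTE; rewrite notin_setE. Qed.

Lemma tau_ge1 x : 1 <= tau A T x.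
Proof using A_bounded rho_ge0 T_SQNE AT_neq0.
have [TA|nTA] := pselect (Fix T (A x)); first by rewrite /tau ifT// inE.
have g0 : 0 < `|adjoint A (residual x)|.
  by rewrite normr_gt0; apply/eqP => /adjoint_residual_eq0/Fix_residual.
by rewrite tau_nFix// exprn_ege1// ler_pdivlMr// mul1r norm_adjoint_le.
Qed.

Lemma step_size_ge0 x : 0 <= tau A T x / opnorm A ^+ 2.
Proof using A_bounded rho_ge0 T_SQNE AT_neq0.
by apply: divr_ge0; [exact: le_trans ler01 (tau_ge1 x)|exact: sqr_ge0].
Qed.

(** When [A x] is a fixed point of [T], both sides are [0], thanks to the convention
[0 / 0 = 0]. *)
Lemma norm_extrapolated_landweber_subr x :
  `|L x - x| = `|residual x| ^+ 2 / `|adjoint A (residual x)|.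
Proof using A_bounded A_neq0 rho_ge0 T_SQNE AT_neq0.
rewrite extrapolated_landweber_subr.
have [/Fix_residual u0|nTA] := pselect (Fix T (A x)).
  by rewrite u0 adjoint0// scaler0 !normr0 expr0n mul0r.
have g0 : `|adjoint A (residual x)| != 0.
  by rewrite normr_eq0; apply/eqP => /adjoint_residual_eq0/Fix_residual.
have A0 : opnorm A != 0 by rewrite gt_eqF// opnorm_gt0.
rewrite normrZ (ger0_norm (step_size_ge0 x)).
by rewrite tau_nFix//; field; rewrite g0 A0.
Qed.

(** Since [`|adjoint A u| <= opnorm A * `|u|], a small extrapolated step forces a
small residual of [T]. *)
Lemma residual_le x : `|residual x| <= opnorm A * `|L x - x|.
Proof using A_bounded A_neq0 rho_ge0 T_SQNE AT_neq0.
have [u0|u0] := eqVneq (residual x) 0.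
  by rewrite u0 normr0 mulr_ge0// opnorm_ge0.
have nu : 0 < `|residual x| by rewrite normr_gt0.
have g0 : 0 < `|adjoint A (residual x)|.
  by rewrite normr_gt0; apply: contra_neq u0; exact: adjoint_residual_eq0.
rewrite norm_extrapolated_landweber_subr mulrA ler_pdivlMr// mulrC expr2 mulrA.
by rewrite ler_pM2r// norm_adjoint_le.
Qed.

Lemma Fix_extrapolated_landweber : Fix L = A @^-1` Fix T.
Proof using A_bounded A_neq0 rho_ge0 T_SQNE AT_neq0.
apply/seteqP; split => x; rewrite /preimage/=.
  rewrite {1}/Fix/= => Lx; apply/Fix_residual/eqP.
  have := residual_le x.
  by rewrite Lx subrr normr0 mulr0 normr_le0.
move=> /Fix_residual u0; apply/subr0_eq.
by rewrite extrapolated_landweber_subr u0 adjoint0// scaler0.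
Qed.

Lemma Fix_extrapolated_landweber_neq0 : Fix L !=set0.
Proof using A_bounded A_neq0 rho_ge0 T_SQNE AT_neq0.
rewrite Fix_extrapolated_landweber.
by have [_ [[c _ <-] Tc]] := AT_neq0; exists c.
Qed.

(** Cauchy-Schwarz in [residual_inner_ge], followed by the infimum over [c]. *)
Lemma residual_dist_le x :
  (rho + 1) / 2 * `|residual x| ^+ 2
    <= `|adjoint A (residual x)| * dist x (Fix L).
Proof using A_bounded A_neq0 rho_ge0 T_SQNE AT_neq0.
have [g0|g0] := eqVneq (adjoint A (residual x)) 0.
  by rewrite g0 (adjoint_residual_eq0 g0) !normr0 expr0n mulr0 mul0r.
have ng : 0 < `|adjoint A (residual x)| by rewrite normr_gt0.
rewrite [leRHS]mulrC -ler_pdivrMr//.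
apply: dist_ge Fix_extrapolated_landweber_neq0 _ => c.
rewrite Fix_extrapolated_landweber ler_pdivrMr// (distrC x c) => Tc.
apply: le_trans (residual_inner_ge x Tc) _.
exact: le_trans (ler_norm _) (cauchy_schwarz _ _).
Qed.

Lemma cvg_residual (x : nat -> H1) :
  `|L (x k) - x k| @[k --> \oo] --> (0 : R) ->
  `|residual (x k)| @[k --> \oo] --> (0 : R).
Proof using A_bounded A_neq0 rho_ge0 T_SQNE AT_neq0.
move=> Lx; apply: (squeeze_cvgr _ (cvg_cst 0)).
  by apply: nearW => k; apply/andP; split; last exact: residual_le.
by rewrite -(mulr0 (opnorm A)); exact: cvgMr.
Qed.

Lemma weakly_regular_extrapolated_landweber S :
  weakly_regular T S -> weakly_regular L (A @^-1` S).
Proof using A_bounded A_neq0 rho_ge0 T_SQNE AT_neq0.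
move=> [_ Treg]; split; first exact: Fix_extrapolated_landweber_neq0.
move=> x l n Sx n_incr xl Lx; rewrite Fix_extrapolated_landweber.
apply: (Treg (A \o x) (A l) n) => //; first exact: (weak_cvg_linear _ xl).
exact/norm_cvg0P/cvg_residual/norm_cvg0P.
Qed.

Lemma dist_Fix_extrapolated_landweber x :
  min_modulus A * dist x (Fix L) <= dist (A x) (range A `&` Fix T).
Proof using A_bounded A_neq0 rho_ge0 T_SQNE AT_neq0.
by rewrite Fix_extrapolated_landweber; exact: dist_preimage_le.
Qed.

Lemma regular_extrapolated_landweber S : closed (range A) ->
  regular T S -> regular_family [:: range A; Fix T] S ->
  regular L (A @^-1` S).
Proof using A_bounded A_neq0 rho_ge0 T_SQNE AT_neq0.
move=> Acl [_ Treg] [_]; rewrite family_meet2 => Creg.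
split; first exact: Fix_extrapolated_landweber_neq0.
move=> x Sx /cvg_residual /(Treg (A \o x) Sx) Tx.
have {}Tx : dist (A (x k)) (range A `&` Fix T) @[k --> \oo] --> (0 : R).
  apply: (Creg (A \o x) Sx).
  by under eq_fun do rewrite /= max_dist2_mem//.
have m0 := min_modulus_gt0 A_bounded A_neq0 Acl.
have mTx : (min_modulus A)^-1 * dist (A (x k)) (range A `&` Fix T)
    @[k --> \oo] --> (0 : R).
  by rewrite -(mulr0 (min_modulus A)^-1); exact: cvgMr.
apply: (squeeze_cvgr _ (cvg_cst 0) mTx).
apply: nearW => k; rewrite dist_ge0/= mulrC ler_pdivlMr// mulrC.
exact: dist_Fix_extrapolated_landweber.
Qed.

Section LinearlyRegular.
Variables (S : set H2) (delta kappa : R).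
Hypothesis Acl : closed (range A).
Hypothesis Treg : linearly_regular T S delta.
Hypothesis Creg : linearly_regular_family [:: range A; Fix T] S kappa.

Lemma dist_Fix_le_residual x : S (A x) ->
  delta * min_modulus A / kappa * dist x (Fix L) <= `|residual x|.
Proof using A_bounded A_neq0 rho_ge0 T_SQNE AT_neq0 Treg Creg.
move=> Sx; have [_ d0 Td] := Treg; have [_ k0 Cd] := Creg.
have := Cd _ Sx; rewrite family_meet2 max_dist2_mem// => Cx.
apply: le_trans (Td _ Sx).
rewrite (_ : _ * dist x _ = delta * (min_modulus A * dist x (Fix L) / kappa)).
  rewrite ler_pM2l// ler_pdivrMr// [leRHS]mulrC.
  exact: le_trans (dist_Fix_extrapolated_landweber x) Cx.
by rewrite mulrAC -!mulrA.
Qed.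

(** [residual_dist_le] bounds [dist x (Fix L)] times the norm of the adjoint residual
from below by a multiple of [`|residual x| ^+ 2], which is itself at least quadratic
in [dist x (Fix L)] by [dist_Fix_le_residual]; one factor [dist x (Fix L)] cancels. *)
Lemma norm_extrapolated_landweber_subr_ge x : S (A x) ->
  tau A T x * ((rho + 1) / 2)
    * (delta * min_modulus A / (kappa * opnorm A)) ^+ 2 * dist x (Fix L)
  <= `|L x - x|.
Proof using A_bounded A_neq0 rho_ge0 T_SQNE AT_neq0 Treg Creg.
move=> Sx; have [_ d0 _] := Treg; have [_ k0 _] := Creg.
have [->|dn0] := eqVneq (dist x (Fix L)) 0; first by rewrite mulr0.
have dpos : 0 < dist x (Fix L) by rewrite lt_def dn0 dist_ge0.
rewrite extrapolated_landweber_subr normrZ (ger0_norm (step_size_ge0 x)).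
set c := delta * min_modulus A / kappa; set h := (rho + 1) / 2.
have -> : delta * min_modulus A / (kappa * opnorm A) = c / opnorm A.
  by rewrite /c invfM mulrA.
rewrite expr_div_n.
rewrite (_ : _ * _ = tau A T x / opnorm A ^+ 2 * (h * c ^+ 2 * dist x (Fix L))).
  apply: ler_wpM2l; first exact: step_size_ge0.
  rewrite -(ler_pM2r dpos); apply: le_trans (residual_dist_le x).
  have -> : h * c ^+ 2 * dist x (Fix L) * dist x (Fix L)
    = h * (c * dist x (Fix L)) ^+ 2 by ring.
  rewrite ler_pM2l ?divr_gt0 ?ltr_wpDl//.
  rewrite ler_pXn2r ?nnegrE//; first exact: dist_Fix_le_residual.
  by rewrite mulr_ge0 ?dist_ge0// divr_ge0 ?mulr_ge0 ?min_modulus_ge0 1?ltW.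
move: (tau A T x) h (c ^+ 2) (opnorm A ^+ 2)^-1 (dist x _) => t h1 c1 o1 d1; ring.
Qed.

Lemma linearly_regular_extrapolated_landweber :
  linearly_regular L (A @^-1` S)
    ((rho + 1) / 2 * (delta * min_modulus A / (kappa * opnorm A)) ^+ 2).
Proof using A_bounded A_neq0 rho_ge0 T_SQNE AT_neq0 Acl Treg Creg.
have [_ d0 _] := Treg; have [_ k0 _] := Creg.
split; first exact: Fix_extrapolated_landweber_neq0.
  rewrite mulr_gt0 ?exprn_gt0 ?divr_gt0 ?mulr_gt0 ?ltr_wpDl//.
    exact: min_modulus_gt0.
  exact: opnorm_gt0.
move=> x Sx; apply: le_trans (norm_extrapolated_landweber_subr_ge Sx).
rewrite -(mulrA (tau A T x)) -(mulrA (tau A T x)) ler_peMl ?tau_ge1//.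
by rewrite mulr_ge0 ?dist_ge0// mulr_ge0 ?sqr_ge0// divr_ge0 ?addr_ge0.
Qed.

End LinearlyRegular.
End ExtrapolatedLandweber.

Unset Implicit Arguments.

Theorem theorem5p3 (R : realType) (H1 H2 : hilbertType R)
    (A : {linear H1 -> H2}) (A_bounded : bounded_near A (nbhs (0 : H1)))
    (A_neq0 : exists x, A x <> 0)
    (rho : R) (rho_ge0 : 0 <= rho)
    (T : H2 -> H2) (T_SQNE : SQNE rho T)
    (S : set H2) (S_neq0 : S !=set0)
    (AT_neq0 : range A `&` Fix T !=set0) :
  let sigma := tau A T in
  let L := extrapolated_landweber A sigma T in
  [/\ weakly_regular T S -> weakly_regular L (A @^-1` S),
      closed (range A) -> regular T S -> bounded_set S ->
      regular_family [:: range A; Fix T] S ->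
      regular L (A @^-1` S) &
      forall delta kappa : R,
        closed (range A) -> linearly_regular T S delta ->
        linearly_regular_family [:: range A; Fix T] S kappa ->
        linearly_regular L (A @^-1` S)
          ((rho + 1) / 2
             * (delta * min_modulus A / (kappa * opnorm A)) ^+ 2)
        /\ forall x, (A @^-1` S) x ->
             sigma x * ((rho + 1) / 2)
               * (delta * min_modulus A / (kappa * opnorm A)) ^+ 2
               * dist x (Fix L) <= `|L x - x| ].
Proof.
move=> sigma L; split.
- exact: (weakly_regular_extrapolated_landweber (rho := rho)).
- by move=> Acl Treg _; exact: (regular_extrapolated_landweber (rho := rho)).
- move=> delta kappa Acl Treg Creg; split.
    exact: linearly_regular_extrapolated_landweber.
  by move=> x; exact: norm_extrapolated_landweber_subr_ge.
Qed.
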